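(* Assume that $\mathrm{MA(countable)}$ holds. Then there exists a non-principal ultrafilter $\mathcal{U}\subseteq 2^\omega$ on $\omega$ such that the infinite power $\mathcal{U}^\omega$ (with the product topology) is countable dense homogeneous.
   Context: Every subset of $\omega$ is identified with its characteristic function, so an ultrafilter on $\omega$ is regarded as a subset of the Cantor set $2^\omega$ and carries the subspace topology. A (separable metrizable) space $X$ is countable dense homogeneous if for every pair $(D,E)$ of countable dense subsets of $X$ there exists a homeomorphism $f:X\to X$ such that $f[D]=E$. $\mathrm{MA(countable)}$ (Martin's Axiom for countable posets) is the statement: for every non-empty countable partially ordered set $\mathbb{P}$ and every collection $\mathcal{D}$ of dense subsets of $\mathbb{P}$ with $|\mathcal{D}|<\mathfrak{c}=2^{\aleph_0}$, there is a filter $G\subseteq\mathbb{P}$ that meets every element of $\mathcal{D}$. *)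

(* Defs.v *)
From HB Require Import structures.
From mathcomp Require Export all_boot all_order.
From mathcomp Require Export all_classical.
From mathcomp Require Export topology cantor.

Set Implicit Arguments.
Unset Strict Implicit.
Unset Printing Implicit Defensive.

Local Open Scope classical_set_scope.
Local Open Scope card_scope.

Definition card_lt (T U : Type) (A : set T) (B : set U) : Prop :=
  A #<= B /\ A #!= B.

Section Poset.
Local Open Scope order_scope.
Context {d : Order.disp_t} {P : porderType d}.

(* Forcing convention: smaller conditions are stronger. *)
Definition poset_dense (D : set P) : Prop :=
  forall p : P, exists2 q : P, D q & q <= p.

Definition poset_filter (G : set P) : Prop :=
  [/\ G !=set0,
      forall p q : P, G p -> p <= q -> G q &
      forall p q : P, G p -> G q -> exists r : P, [/\ G r, r <= p & r <= q]].

End Poset.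

Definition MA_countable : Prop :=
  forall (d : Order.disp_t) (P : porderType d),
    [set: P] !=set0 -> countable [set: P] ->
  forall DD : set (set P),
    (forall D, DD D -> poset_dense D) ->
    card_lt DD [set: nat -> bool] ->
  exists2 G : set P, poset_filter G & forall D, DD D -> G `&` D !=set0.

Definition homeomorphism (X Y : topologicalType) (f : X -> Y) : Prop :=
  continuous f /\
  exists g : Y -> X, [/\ continuous g, cancel f g & cancel g f].

(* Meant for separable metrizable X (without a countable dense subset the
   condition is vacuous). Countable sets may be finite. *)
Definition countable_dense_homogeneous (X : topologicalType) : Prop :=
  forall D E : set X,
    countable D -> dense D -> countable E -> dense E ->
  exists f : X -> X, homeomorphism f /\ f @` D = E.

Definition nonprincipal (T : Type) (U : set_system T) : Prop :=
  forall x : T, U <> principal_filter x.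

(* A family of subsets of nat, seen inside the Cantor set through
   characteristic functions. *)
Definition char_functions (U : set_system nat) : set cantor_space :=
  [set x : cantor_space | U [set n | x n]].

(* The coercion to a type is set_type, which carries the topology induced by
   the Cantor set. *)
Definition char_space (U : set_system nat) : topologicalType :=
  char_functions U.

Definition infinite_power (X : topologicalType) : topologicalType :=
  prod_topology (fun _ : nat => X).

(* Main.v *)
From HB Require Import structures.
Require Import Defs.
From mathcomp Require Import wochoice.

Set Implicit Arguments.
Unset Strict Implicit.
Unset Printing Implicit Defensive.

Local Open Scope classical_set_scope.

(** The ultrafilter is any ultrafilter U extending a family of subsets of nat
    that is built in continuum many stages, one for each pair (D, E) of
    sequences of points of (2^nat)^nat.  The family is kept centered: finitely
    many of its members always have an infinite intersection.  Each stage adds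
    countably many sets which decide the fate of the pair (D, E)
    ([settling_stage]).

    If some coordinate of some point of D or of E has a complement that can be
    added, it is added.  That point is then outside U^nat, and the pair has
    nothing to say about U^nat.

    Otherwise all the coordinates of all these points belong to the filter F
    generated so far and by the cofinite sets.  Identify (2^nat)^nat with 2^nat
    by a bijection [code] of nat * nat with nat, and look for a homeomorphism f
    of 2^nat that is an automorphism of the binary tree: f flips bit k of x
    or not according to the first k bits of x ([twist]).  A finite condition is
    a table of flips for finitely many levels, together with finitely many
    pairs (i, j) for which f (D i) = E j is promised.  Density of D and E allows
    every i and every j to be served, so that f[D] = E.  Moreover, given X in F
    and M, some i in X can be kept free of flips in the coordinates (m, i),
    m < M: it suffices that D a and E b agree at these coordinates for
    the finitely many promised pairs (a, b), and they do, with common value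
    true, for i in the intersection of the coordinates involved, an element
    of F.  Hence, for a generic f, the sets
    G m = {i | level code (m, i) is free of flips} can be added to the family
    ([generic_twist]).  For x in U^nat the sets (f x) m and x m agree on
    G m, which belongs to U, so f maps U^nat onto itself
    ([twist_homeomorphism]).

    There are fewer than continuum many requirements at each stage, which is
    what Martin's axiom asks for, provided the finite intersections of a family
    of size less than the continuum are still fewer than the continuum.  This
    is secured by choosing the well-ordering of the stages appropriately
    ([nongenerating_well_order]). *)

(** * A well-ordering with small initial segments *)

Definition strict_well_order (I : Type) (lt : I -> I -> Prop) : Prop :=
  [/\ well_founded lt,
      forall x y z, lt x y -> lt y z -> lt x z &
      forall x y, [\/ lt x y, x = y | lt y x]].

Lemma well_founded_min (I : Type) (lt : I -> I -> Prop) (P : set I) :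
  well_founded lt -> P !=set0 ->
  exists2 m, P m & forall y, P y -> ~ lt y m.
Proof.
move=> wf [x]; elim/(well_founded_ind wf): x => x IH Px.
have [[y [Py yx]]|nomin] := pselect (exists y, P y /\ lt y x).
  exact: IH Py.
by exists x => // y Py yx; apply: nomin; exists y.
Qed.

Lemma strict_well_order_exists (I : eqType) :
  exists lt : I -> I -> Prop, strict_well_order lt.
Proof.
have [R Rwo] := well_ordering_principle I.
have Rch : wo_chain R predT by move=> A _; exact: Rwo.
have Rtot x y : R x y || R y x by exact: (wo_chainW Rch).
have Ranti x y : R x y -> R y x -> x = y.
  by move=> xy yx; apply: (wo_chain_antisymmetric Rch); rewrite // xy.
have wf : well_founded (fun x y => R x y /\ x <> y).
  move=> x; apply: contrapT => nAx.
  have [|z [[]]] := Rwo [pred y | `[< ~ Acc (fun x y => R x y /\ x <> y) y >]].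
    by exists x; apply/asboolP.
  move=> /asboolP nAz zmin _; apply: nAz; constructor => y [yz ne].
  apply: contrapT => nAy; apply: ne; apply: Ranti => //.
  by apply: zmin; apply/asboolP.
have tri x y : [\/ R x y /\ x <> y, x = y | R y x /\ y <> x].
  have [->|/eqP ne] := eqVneq x y; first by constructor 2.
  by case/orP: (Rtot x y) => Rxy;
    [constructor 1|constructor 3; split=> // /esym].
exists (fun x y => R x y /\ x <> y); split=> // x y z xy yz.
(* A failure of transitivity is a cycle, which has no minimal element. *)
have [|m [] -> mmin] :=
    @well_founded_min _ _ [set t | [\/ t = x, t = y | t = z]] wf.
- by exists x; constructor 1.
- have [//|xz|zx] := tri x z.
    by case: (mmin y); [constructor 2|rewrite xz].
  by case: (mmin z); [constructor 3|].
- by case: (mmin x); [constructor 1|].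
- by case: (mmin y); [constructor 2|].
Qed.

(** For infinite A this says that A is at least as large as I.  Finitary
    operations are built in because the requirements met at a stage are indexed
    by finite sequences of earlier stages: families indexed by seq A and by nat
    are thereby handled together, without comparing cardinals. *)
Definition generates (I : eqType) (A : set I) : Prop :=
  exists op : nat -> seq I -> I,
    forall x, exists n s, (forall y, y \in s -> A y) /\ op n s = x.

(** Operations compose: the elements of a sequence over B are replaced by
    sequences over A and b, which are concatenated; the way to cut the result
    back into pieces is a finite datum, stored in the index of the operation.
    The occurrences of b are stored there as well. *)
Lemma generates_trans (I : eqType) (A B : set I) (b : I)
    (op : nat -> seq I -> I) :
  (forall y, B y ->
     exists n s, (forall z, z \in s -> z = b \/ A z) /\ op n s = y) ->
  generates B -> generates A.
Proof.
move=> gB [opB gI].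
have /choice[f fP] y : exists f : nat * seq I,
    B y -> (forall z, z \in f.2 -> z = b \/ A z) /\ op f.1 f.2 = y.
  have [/gB[n [s sP]]|nBy] := pselect (B y); last by exists (0, [::]).
  by exists (n, s).
pose dec (s : seq I) (p : nat * seq nat) :=
  op p.1 [seq nth b s k | k <- p.2].
exists (fun c s => if (unpickle c : option (nat * seq (nat * seq nat)))
  is Some (n, l) then opB n [seq dec s p | p <- l] else b) => x.
have [n [s [sB <-]]] := gI x.
pose s' := [seq z <- flatten [seq (f y).2 | y <- s] | z != b].
pose l := [seq ((f y).1, [seq index z s' | z <- (f y).2]) | y <- s].
exists (pickle (n, l)), s'; rewrite pickleK; split.
  move=> z; rewrite mem_filter => /andP[/eqP zb /flatten_mapP[y ys zy]].
  by have [/(_ _ zy)[]] := fP _ (sB _ ys).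
congr (opB n _); rewrite -[RHS]map_id -map_comp; apply/eq_in_map => y ys /=.
have [_ yE] := fP _ (sB _ ys); rewrite /dec /= -map_comp -[RHS]yE.
congr (op _ _).
rewrite -[RHS]map_id; apply/eq_in_map => z zy /=.
(* The positions of b are out of range, so that the default value b is read. *)
have [zb|zb] := eqVneq z b; last first.
  by rewrite nth_index // mem_filter zb; apply/flatten_mapP; exists y.
by rewrite memNindex ?nth_default // mem_filter zb eqxx.
Qed.

(** Let a be minimal among the points whose initial segment generates I in an
    arbitrary well-ordering.  Each x is the value of an operation on arguments
    below or equal to some b < a, chosen as the rank of x.  Ordering by rank
    first, an initial segment is contained in what the points up to some b < a
    produce, and would only generate I if the initial segment of b did, against
    the minimality of a. *)
Lemma nongenerating_well_order (I : eqType) : ~ countable [set: I] ->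
  exists lt : I -> I -> Prop, strict_well_order lt /\
    forall a, ~ generates [set x | lt x a].
Proof.
move=> ncI; have [lt [wf tr tri]] := strict_well_order_exists I.
have irr x : ~ lt x x.
  move=> xx; have [|m -> /(_ _ erefl)//] := @well_founded_min _ _ [set x] wf.
  by exists x.
have [[a0 ga0]|] := pselect (exists a, generates [set x | lt x a]); last first.
  by move=> /forallNP nga; exists lt.
have [|a [op opP] amin] :=
    @well_founded_min _ _ [set a | generates [set x | lt x a]] wf.
  by exists a0.
(* Otherwise the countably many op n [::] would be all of I. *)
have [e0 e0a] : exists e, lt e a.
  apply: contrapT => /forallNP noe; apply: ncI.
  suff -> : [set: I] = range (fun n => op n [::]).
    exact: card_le_trans (card_image_le _ _) (countableP _).
  apply/seteqP; split=> // x _; have [n [[|z s] [sa <-]]] := opP x.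
    by exists n.
  by case: (noe z); apply: sa; rewrite mem_head.
pose le x y := x = y \/ lt x y.
have bound (s : seq I) : (forall y, y \in s -> lt y a) ->
    exists2 b, lt b a & forall y, y \in s -> le y b.
  elim: s => [|z s IH] sa; first by exists e0.
  have [|b ba sb] := IH; first by move=> y ys; apply: sa; rewrite inE ys orbT.
  have za : lt z a by apply: sa; rewrite mem_head.
  have [zb|zb|bz] := tri z b; [exists b|exists b|exists z] => // y;
    rewrite inE => /orP[/eqP->|/sb].
  - by right.
  - by [].
  - by left.
  - by [].
  - by left.
  - by case=> [->|yb]; right=> //; exact: tr bz.
have /choice[rk rkP] x : exists b, lt b a /\
    (exists n s, (forall y, y \in s -> y = b \/ lt y b) /\ op n s = x).
  have [n [s [sa <-]]] := opP x; have [b ba sb] := bound s sa.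
  by exists b; split=> //; exists n, s.
pose lt' x y := lt (rk x) (rk y) \/ rk x = rk y /\ lt x y.
exists lt'; split; first split.
- suff wf' b x : rk x = b -> Acc lt' x by move=> x; exact: wf'.
  elim/(well_founded_ind wf): b x => b IHb x; elim/(well_founded_ind wf): x.
  move=> x IHx xb; constructor => y [yx|[yx ltyx]].
    by apply: IHb erefl; rewrite -xb.
  by apply: IHx => //; rewrite yx.
- move=> x y z [xy|[xy ltxy]] [yz|[yz ltyz]].
  + by left; exact: tr yz.
  + by left; rewrite -yz.
  + by left; rewrite xy.
  + by right; split; [rewrite xy|exact: tr ltyz].
- move=> x y; have [|e|] := tri (rk x) (rk y).
  + by constructor 1; left.
  + by have [|->|] := tri x y; [constructor 1; right|constructor 2|
                                constructor 3; right].
  + by constructor 3; left.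
move=> y gy; have [ya _] := rkP y; apply: amin ya.
apply: (generates_trans (b := rk y) (op := op)) gy => x xy.
have [_ [n [s [sx opx]]]] := rkP x; exists n, s; split=> // z /sx zx.
case: xy => [rxy|[<- _]//].
by right; case: zx => [->//|/tr]; apply.
Qed.

(** * Martin's axiom for nongenerating index sets *)

(** A bijection between the family of dense sets and 2^nat would turn
    D into a family of operations generating 2^nat from A. *)
Lemma generic_filter (A : set (nat -> bool)) (d : Order.disp_t)
    (P : porderType d) (D : nat -> seq (nat -> bool) -> set P) :
  MA_countable -> ~ generates A ->
  [set: P] !=set0 -> countable [set: P] ->
  (forall n s, (forall a, a \in s -> A a) -> poset_dense (D n s)) ->
  exists2 G : set P, poset_filter G &
    forall n s, (forall a, a \in s -> A a) -> G `&` D n s !=set0.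
Proof.
move=> MA nA P0 cP Ddense.
pose DD := [set E | exists n s, (forall a, a \in s -> A a) /\ E = D n s].
suff DDc : card_lt DD [set: nat -> bool].
  have [_ [n [s [sA ->]]]|G Gfilt GD] := MA d P P0 cP DD _ DDc.
    exact: Ddense.
  by exists G => // n s sA; apply: GD; exists n, s.
split.
- have /countable_injP[f finj] := cP.
  pose code (E : set P) n := `[< exists2 p, E p & f p = n >].
  have sub E1 E2 : code E1 = code E2 -> E1 `<=` E2.
    move=> eqE p E1p; have : code E1 (f p) by apply/asboolP; exists p.
    rewrite eqE => /asboolP[q E2q fqp].
    by rewrite -(finj q p) ?inE.
  apply/pcard_injP; exists code.
  by move=> E1 E2 _ _ eqE; apply/seteqP; split; exact: sub.
- apply/negP => /card_set_bijP[f [_ _ fsurj]]; apply: nA.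
  exists (fun n s => f (D n s)) => x.
  by have [_ [n [s [sA ->]]] <-] := fsurj x I; exists n, s.
Qed.

(** * Automorphisms of the binary tree *)

Lemma mkseqP (T : Type) (x y : nat -> T) n :
  mkseq x n = mkseq y n <-> forall k, k < n -> x k = y k.
Proof.
split=> [e k kn|e]; last first.
  by apply/eq_in_map => k; rewrite mem_iota => /andP[_]; exact: e.
have x0 := x 0; have := congr1 (fun s => nth (x 0) s k) e.
by rewrite !nth_mkseq.
Qed.

Lemma mkseq_le (T : Type) (x y : nat -> T) m n : m <= n ->
  mkseq x n = mkseq y n -> mkseq x m = mkseq y m.
Proof.
by move=> mn /mkseqP e; apply/mkseqP => k km; apply: e; exact: leq_trans mn.
Qed.

Lemma separating_level (x : nat -> bool) (s : seq (nat -> bool)) :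
  exists n, forall y, y \in s -> mkseq y n = mkseq x n -> y = x.
Proof.
elim: s => [|z s [n nP]]; first by exists 0.
have [->|/eqP zx] := eqVneq z x.
  by exists n => y; rewrite inE => /orP[/eqP->//|]; exact: nP.
have [k zxk] : exists k, z k <> x k.
  by apply: contrapT => /forallNP zx'; apply/zx/funext => k; exact: contrapT.
exists (maxn n k.+1) => y; rewrite inE => /orP[/eqP->|ys] e.
  case: zxk; apply/(mkseqP z x k.+1).1 => //.
  by apply: mkseq_le e; exact: leq_maxr.
by apply: nP ys _; apply: mkseq_le e; exact: leq_maxl.
Qed.

(** The level-preserving automorphisms of the binary tree: flips k lists the
    nodes of level k at which the two subtrees are exchanged. *)
Definition twist (flips : nat -> seq (seq bool)) (x : nat -> bool) :
    nat -> bool :=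
  fun k => x k (+) (mkseq x k \in flips k).

Fixpoint untwist_prefix (flips : nat -> seq (seq bool)) (y : nat -> bool) n :=
  if n is k.+1 then
    let s := untwist_prefix flips y k in rcons s (y k (+) (s \in flips k))
  else [::].

Definition untwist (flips : nat -> seq (seq bool)) (y : nat -> bool) :
    nat -> bool :=
  fun k => y k (+) (untwist_prefix flips y k \in flips k).

Section TwistTheory.
Context (flips : nat -> seq (seq bool)).

Lemma mkseq_untwist y n : mkseq (untwist flips y) n = untwist_prefix flips y n.
Proof. by elim: n => // n IH; rewrite mkseqS IH. Qed.

Lemma untwistK : cancel (untwist flips) (twist flips).
Proof.
by move=> y; apply/funext => k; rewrite /twist mkseq_untwist /untwist addbK.
Qed.

Lemma eq_mkseq_twist x y n :
  mkseq (twist flips x) n = mkseq (twist flips y) n <->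
  mkseq x n = mkseq y n.
Proof.
elim: n => // n IH; rewrite !mkseqS; split.
  move=> /rcons_inj[/IH e]; rewrite /twist e => /addIb xy.
  by rewrite xy.
move=> /rcons_inj[e xy]; rewrite (IH.2 e); congr rcons.
by rewrite /twist e xy.
Qed.

Lemma twist_inj : injective (twist flips).
Proof.
move=> x y e; apply/funext => k; apply/(mkseqP x y k.+1).1 => //.
by apply/eq_mkseq_twist; rewrite e.
Qed.

Lemma twistK : cancel (twist flips) (untwist flips).
Proof. by move=> x; apply: twist_inj; rewrite untwistK. Qed.

Lemma mkseq_untwist_eq x y n :
  mkseq x n = mkseq y n ->
  mkseq (untwist flips x) n = mkseq (untwist flips y) n.
Proof. by move=> e; apply/eq_mkseq_twist; rewrite !untwistK. Qed.

End TwistTheory.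

(** * The forcing: back and forth with free levels *)

Section BackAndForth.
Context (D E : nat -> nat -> bool).

Definition table (t : seq (seq (seq bool))) : nat -> seq (seq bool) :=
  fun k => nth [::] t k.

(** The second clause is what keeps a condition extendable: distinct promised
    points are already separated, so their later bits can be dealt with
    independently. *)
Definition promises_kept (g : seq (nat * nat)) (t : seq (seq (seq bool))) :
    Prop :=
  (forall p, p \in g -> forall k, k < size t ->
     twist (table t) (D p.1) k = E p.2 k) /\
  (forall p q, p \in g -> q \in g ->
     mkseq (D p.1) (size t) = mkseq (D q.1) (size t) ->
     D p.1 = D q.1 /\ E p.2 = E q.2).

Definition condition : Type :=
  {c : seq (nat * nat) * seq (seq (seq bool)) | `[< promises_kept c.1 c.2 >]}.

HB.instance Definition _ := [Countable of condition by <:].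

Definition stronger (c' c : condition) : bool :=
  prefix (val c).1 (val c').1 && prefix (val c).2 (val c').2.

Lemma stronger_refl : reflexive stronger.
Proof. by move=> c; rewrite /stronger !prefix_refl. Qed.

Lemma stronger_anti : antisymmetric stronger.
Proof.
have prefix_anti (T : eqType) (s t : seq T) : prefix s t -> prefix t s -> s = t.
  move=> st ts.
  have sz : size s = size t by apply/eqP; rewrite eqn_leq !size_prefix.
  by move: st; rewrite prefixE sz take_size => /eqP.
move=> c c' /andP[/andP[g1 t1] /andP[g2 t2]]; apply/val_inj.
rewrite [LHS]surjective_pairing [RHS]surjective_pairing.
by rewrite (prefix_anti _ _ _ g1 g2) (prefix_anti _ _ _ t1 t2).
Qed.

Lemma stronger_trans : transitive stronger.
Proof.
move=> c c1 c2 /andP[g1 t1] /andP[g2 t2]; apply/andP; split.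
  exact: prefix_trans g2 g1.
exact: prefix_trans t2 t1.
Qed.

HB.instance Definition _ := Order.Le_isPOrder.Build (Order.Disp tt tt) condition
  stronger_refl stronger_anti stronger_trans.

Definition pairs (c : condition) := (val c).1.
Definition flip_table (c : condition) := (val c).2.

Lemma conditionP c : promises_kept (pairs c) (flip_table c).
Proof. by case: c => -[g t] /= gt; exact/asboolP. Qed.

Lemma stronger_pairs (c' c : condition) : (c' <= c)%O ->
  {subset pairs c <= pairs c'}.
Proof. by move=> /andP[/prefixP[s e] _] p pc; rewrite /pairs e mem_cat pc. Qed.

Lemma stronger_table (c' c : condition) k : (c' <= c)%O ->
  k < size (flip_table c) ->
  k < size (flip_table c') /\ table (flip_table c') k = table (flip_table c) k.
Proof.
move=> /andP[_ /prefixP[s e]] kc; rewrite /flip_table e size_cat /table nth_cat.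
by rewrite kc (leq_trans kc) ?leq_addr.
Qed.

Definition demanded_flips (g : seq (nat * nat)) k : seq (seq bool) :=
  [seq mkseq (D p.1) k | p <- g & D p.1 k != E p.2 k].

(** Flipping exactly where the promised pairs demand it keeps the promises: by
    the separation clause, a node of a new level is on the branch of at most
    one promised point, so the demands do not conflict. *)
Lemma extend_condition (c : condition) n : exists c' : condition,
  [/\ (c' <= c)%O, pairs c' = pairs c, n <= size (flip_table c') &
      forall k, size (flip_table c) <= k < size (flip_table c') ->
        table (flip_table c') k = demanded_flips (pairs c) k].
Proof.
have [agree apart] := conditionP c.
set g := pairs c in agree apart *; set t := flip_table c in agree apart *.
pose t' := t ++ [seq demanded_flips g k | k <- iota (size t) (n - size t)].
have tt' : size t <= size t' by rewrite size_cat leq_addr.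
have old k : k < size t -> table t' k = table t k.
  by move=> kt; rewrite /table nth_cat kt.
have new k : size t <= k < size t' -> table t' k = demanded_flips g k.
  rewrite size_cat size_map size_iota => /andP[tk kt'].
  have kt : k - size t < n - size t by rewrite ltn_subLR.
  rewrite /table nth_cat ltnNge tk (nth_map 0) ?size_iota //.
  by rewrite nth_iota // subnKC.
have gt' : promises_kept g t'.
  split=> [p pg k kt'|p q pg qg e] /=; last first.
    by apply: apart => //; exact: mkseq_le e.
  have [kt|tk] := ltnP k (size t).
    by rewrite /twist old //; exact: agree.
  rewrite /twist new ?tk //.
  suff -> : (mkseq (D p.1) k \in demanded_flips g k) = (D p.1 k != E p.2 k).
    by case: (D p.1 k) (E p.2 k) => -[].
  apply/mapP/idP => [[q] |pk]; last by exists p; rewrite // mem_filter pk.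
  rewrite mem_filter => /andP[qk qg] /(mkseq_le tk)/apart[] // -> ->.
  exact: qk.
exists (Sub (g, t') (asboolT gt') : condition); split=> //.
- by rewrite /Order.le /= /stronger /= prefix_refl prefix_prefix.
- by rewrite /flip_table /= size_cat size_map size_iota -maxnE leq_maxr.
Qed.

Lemma add_promise (c : condition) p :
  (forall k, k < size (flip_table c) ->
     twist (table (flip_table c)) (D p.1) k = E p.2 k) ->
  (forall q, q \in pairs c ->
     mkseq (D q.1) (size (flip_table c)) =
       mkseq (D p.1) (size (flip_table c)) ->
     D q.1 = D p.1 /\ E q.2 = E p.2) ->
  exists2 c' : condition, (c' <= c)%O & p \in pairs c'.
Proof.
move=> agp app; have [agree apart] := conditionP c.
have gt' : promises_kept (rcons (pairs c) p) (flip_table c).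
  split=> /= [q|q q'].
    by rewrite mem_rcons inE => /orP[/eqP->|/agree].
  rewrite !mem_rcons !inE => /orP[/eqP->|qc] /orP[/eqP->|q'c] //.
  - by move=> /esym/(app _ q'c)[-> ->].
  - exact: app.
  - exact: apart.
exists (Sub (rcons (pairs c) p, flip_table c) (asboolT gt') : condition);
  last by rewrite /pairs /= mem_rcons mem_head.
by rewrite /Order.le /= /stronger /= prefix_refl prefix_rcons.
Qed.

(** Once D i is separated from the other promised points, every point with the
    prefix that the flips decided so far impose on the image of D i is an
    admissible partner, and E has one. *)
Lemma dense_forth i : (forall x n, exists j, mkseq (E j) n = mkseq x n) ->
  poset_dense [set c : condition | exists j, (i, j) \in pairs c].
Proof.
move=> Edense c.
have [N NP] := separating_level (D i) [seq D q.1 | q <- pairs c].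
have [c1 [c1c g1 Nc1 _]] := extend_condition c N.
have sep q : q \in pairs c1 -> mkseq (D q.1) (size (flip_table c1)) =
    mkseq (D i) (size (flip_table c1)) -> D q.1 = D i.
  rewrite g1 => qc /(mkseq_le Nc1); apply: NP.
  by apply/mapP; exists q.
have [agree apart] := conditionP c1.
suff [j [agj apj]] : exists j, (forall k, k < size (flip_table c1) ->
     twist (table (flip_table c1)) (D i) k = E j k) /\
  (forall q, q \in pairs c1 -> D q.1 = D i -> E q.2 = E j).
  have [//|q qc1 e|c2 c2c1 ijc2] := @add_promise c1 (i, j).
    by have Dq := sep q qc1 e; split=> //; exact: apj.
  by exists c2; [exists j|exact: Order.POrderTheory.le_trans c2c1 c1c].
have [[p pc1 Dp]|nop] := pselect (exists2 p, p \in pairs c1 & D p.1 = D i).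
  exists p.2; split=> [k kc1|q qc1 Dq]; first by rewrite -Dp; exact: agree.
  by have [|//] := apart q p qc1 pc1; rewrite Dq Dp.
have [j /mkseqP jP] := Edense (twist (table (flip_table c1)) (D i))
  (size (flip_table c1)).
exists j; split=> [k kc1|q qc1 Dq]; first by rewrite jP.
by case: nop; exists q.
Qed.

Lemma dense_back j : (forall x n, exists i, mkseq (D i) n = mkseq x n) ->
  poset_dense [set c : condition | exists i, (i, j) \in pairs c].
Proof.
move=> Ddense c.
have [N NP] := separating_level (E j) [seq E q.2 | q <- pairs c].
have [c1 [c1c g1 Nc1 _]] := extend_condition c N.
have [agree apart] := conditionP c1.
set n := size (flip_table c1) in Nc1 agree apart.
set F := table (flip_table c1) in agree.
have sep q : q \in pairs c1 -> mkseq (E q.2) n = mkseq (E j) n -> E q.2 = E j.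
  rewrite g1 => qc /(mkseq_le Nc1); apply: NP.
  by apply/mapP; exists q.
suff [i [agi api]] : exists i, (forall k, k < n -> twist F (D i) k = E j k) /\
  (forall q, q \in pairs c1 -> E q.2 = E j -> D q.1 = D i).
  have [//|q qc1 e|c2 c2c1 ijc2] := @add_promise c1 (i, j).
    suff Eq : E q.2 = E j by split=> //; exact: api.
    apply: sep => //; apply/mkseqP => k kn.
    rewrite -agree // -agi //.
    by apply: (mkseqP _ _ n).1 => //; apply/eq_mkseq_twist.
  by exists c2; [exists i|exact: Order.POrderTheory.le_trans c2c1 c1c].
have [[p pc1 Ep]|nop] := pselect (exists2 p, p \in pairs c1 & E p.2 = E j).
  exists p.1; split=> [k kc1|q qc1 Eq]; first by rewrite -Ep; exact: agree.
  have [|//] := apart q p qc1 pc1; apply/(eq_mkseq_twist F)/mkseqP => k kn.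
  by rewrite !agree // Eq Ep.
have [i iP] := Ddense (untwist F (E j)) n.
exists i; split=> [k kn|q qc1 Eq]; last by case: nop; exists q.
apply: (mkseqP _ _ n).1 => //; rewrite -[in RHS](untwistK F (E j)).
exact/eq_mkseq_twist.
Qed.

(** Levels at which all promised pairs agree receive no flips. *)
Lemma dense_unflipped (K : set (seq nat)) :
  (forall (g : seq (nat * nat)) N, exists2 ks, K ks &
     forall k, k \in ks -> N <= k /\ forall p, p \in g -> D p.1 k = E p.2 k) ->
  poset_dense [set c : condition | exists2 ks, K ks & forall k, k \in ks ->
    k < size (flip_table c) /\ table (flip_table c) k = [::]].
Proof.
move=> Kwide c; have [ks Kks ksP] := Kwide (pairs c) (size (flip_table c)).
have [c' [c'c _ ksc' c'P]] := extend_condition c (\max_(k <- ks) k).+1.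
exists c' => //; exists ks => // k kks; have [ck agk] := ksP k kks.
have kc' : k < size (flip_table c').
  by apply: leq_trans ksc'; rewrite ltnS; exact: leq_bigmax_seq.
split=> //; rewrite c'P ?ck // /demanded_flips.
rewrite (eq_in_filter (a2 := pred0)) ?filter_pred0 // => p pc.
by rewrite agk // eqxx.
Qed.
End BackAndForth.

(** A generic filter decides the flips at all levels and serves all indices.
    The sets K m s are the requirements for free levels: each of them contains
    finite sets of levels, arbitrarily far out, at which any finitely many
    pairs (D a, E b) agree. *)
Lemma generic_twist (A : set (nat -> bool)) (D E : nat -> nat -> bool)
    (K : nat -> seq (nat -> bool) -> set (seq nat)) :
  MA_countable -> ~ generates A ->
  (forall x n, exists i, mkseq (D i) n = mkseq x n) ->
  (forall x n, exists j, mkseq (E j) n = mkseq x n) ->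
  (forall m s, (forall a, a \in s -> A a) ->
     forall (g : seq (nat * nat)) N, exists2 ks, K m s ks &
       forall k, k \in ks ->
         N <= k /\ forall p, p \in g -> D p.1 k = E p.2 k) ->
  exists flips,
    [/\ forall i, exists j, twist flips (D i) = E j,
        forall j, exists i, twist flips (D i) = E j &
        forall m s, (forall a, a \in s -> A a) ->
          exists2 ks, K m s ks & forall k, k \in ks -> flips k = [::]].
Proof.
move=> MA nA Ddense Edense Kwide.
pose decided k := [set c : condition D E | k < size (flip_table c)].
pose forth i := [set c : condition D E | exists j, (i, j) \in pairs c].
pose back j := [set c : condition D E | exists i, (i, j) \in pairs c].
pose unflipped (L : set (seq nat)) := [set c : condition D E |
  exists2 ks, L ks & forall k, k \in ks ->
    k < size (flip_table c) /\ table (flip_table c) k = [::]].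
pose task := ((nat + nat) + (nat + nat))%type.
pose tasks n s := match (unpickle n : option task) with
  | Some (inl (inl k)) => decided k
  | Some (inl (inr i)) => forth i
  | Some (inr (inl j)) => back j
  | Some (inr (inr m)) => unflipped (K m s)
  | None => setT
  end.
have tasksE (n : task) s : tasks (pickle n) s = match n with
  | inl (inl k) => decided k | inl (inr i) => forth i
  | inr (inl j) => back j | inr (inr m) => unflipped (K m s) end.
  by rewrite /tasks pickleK.
have [|||G [_ _ Gdir] Gtasks] :=
  @generic_filter A _ (condition D E) tasks MA nA.
- have gt0 : promises_kept D E [::] [::] by [].
  by exists (Sub ([::], [::]) (asboolT gt0) : condition D E).
- exact: countableP.
- move=> n s sA; rewrite /tasks.
  case: unpickle => [[[k|i]|[j|m]]|]; last by move=> c; exists c.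
  + move=> c; have [c' [c'c _ kc' _]] := extend_condition c k.+1.
    by exists c'.
  + exact: dense_forth.
  + exact: dense_back.
  + by apply: dense_unflipped; exact: Kwide.
have meet0 (n : task) : G `&` tasks (pickle n) [::] !=set0 by exact: Gtasks.
have /choice[cs csP] k : exists c, G c /\ k < size (flip_table c).
  by have [c [Gc]] := meet0 (inl (inl k)); rewrite tasksE => kc; exists c.
pose flips k := table (flip_table (cs k)) k.
have flipsE c k : G c -> k < size (flip_table c) ->
    table (flip_table c) k = flips k.
  move=> Gc kc; have [Gck kck] := csP k; have [r [_ rc rck]] := Gdir _ _ Gc Gck.
  by rewrite -(stronger_table rc kc).2 (stronger_table rck kck).2.
have promised p c : G c -> p \in pairs c -> twist flips (D p.1) = E p.2.
  move=> Gc pc; apply/funext => k; have [Gck kck] := csP k.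
  have [r [Gr rc rck]] := Gdir _ _ Gc Gck.
  have [agree _] := conditionP r; have kr := (stronger_table rck kck).1.
  rewrite -(agree p) //=; last exact: stronger_pairs pc.
  by rewrite /twist -(flipsE r).
exists flips; split=> [i|j|m s sA].
- have [c [Gc]] := meet0 (inl (inr i)); rewrite tasksE => -[j ijc].
  by exists j; exact: (promised (i, j) c).
- have [c [Gc]] := meet0 (inr (inl j)); rewrite tasksE => -[i ijc].
  by exists i; exact: (promised (i, j) c).
- have [c [Gc]] := Gtasks (pickle (inr (inr m) : task)) s sA.
  rewrite tasksE => -[ks Kks ksP]; exists ks => // k /ksP[kc <-].
  by rewrite (flipsE c).
Qed.

(** * One stage of the construction *)

Lemma filter_all (T : Type) (J : eqType) (F : set_system T) (X : J -> set T)
    (l : seq J) : Filter F ->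
  (forall j, j \in l -> F (X j)) -> F [set i | forall j, j \in l -> X j i].
Proof.
move=> FF; elim: l => [|j l IH] Fl; first by apply: filterS filterT => i.
have Fj : F (X j) by apply: Fl; rewrite mem_head.
have {}IH : F [set i | forall j, j \in l -> X j i].
  by apply: IH => j' j'l; apply: Fl; rewrite inE j'l orbT.
apply: filterS (filterI Fj IH) => i [Xi Xli] j'.
by rewrite inE => /orP[/eqP->//|]; exact: Xli.
Qed.

Lemma mem_zipl (T U : eqType) (s : seq T) (t : seq U) a b :
  (a, b) \in zip s t -> a \in s.
Proof.
elim: s t => [|x s IH] [|y t] //=; rewrite !inE.
by move=> /orP[/eqP[-> _]|/IH->]; rewrite ?eqxx ?orbT.
Qed.

(** The filter generated by S and the cofinite sets. *)
Definition generated_filter (S : set (set nat)) : set_system nat :=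
  [set X | exists2 l : seq (set nat), (forall Y, Y \in l -> S Y) &
    exists N, forall i, N <= i -> (forall Y, Y \in l -> Y i) -> X i].

Definition centered (S : set (set nat)) : Prop :=
  forall X, generated_filter S X -> X !=set0.

#[global] Instance generated_filter_filter S : Filter (generated_filter S).
Proof.
split.
- by exists [::] => //; exists 0.
- move=> X Y [l lS [N lX]] [l' l'S [N' l'Y]]; exists (l ++ l').
    by move=> Z; rewrite mem_cat => /orP[/lS|/l'S].
  exists (maxn N N') => i; rewrite geq_max => /andP[Ni N'i] ll'i; split.
    by apply: lX => // Z Zl; apply: ll'i; rewrite mem_cat Zl.
  by apply: l'Y => // Z Zl; apply: ll'i; rewrite mem_cat Zl orbT.
- move=> X Y XY [l lS [N lX]]; exists l => //; exists N => i Ni li.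
  by apply: XY; exact: lX.
Qed.

Lemma generated_filter_sub S X : S X -> generated_filter S X.
Proof.
move=> SX; exists [:: X] => [Y|]; first by rewrite inE => /eqP->.
by exists 0 => i _; apply; rewrite mem_head.
Qed.

Lemma generated_filter_cofinite S N : generated_filter S [set i | N <= i].
Proof. by exists [::] => //; exists N. Qed.

Lemma generated_filter_adjoin S (G : nat -> set nat) X :
  generated_filter (S `|` range G) X ->
  exists M, exists2 Y, generated_filter S Y &
    forall i, Y i -> (forall m, m < M -> G m i) -> X i.
Proof.
move=> [l lSG [N lX]].
suff [M [Y SY MY]] : exists M, exists2 Y, generated_filter S Y &
    forall i, Y i -> (forall m, m < M -> G m i) -> forall Z, Z \in l -> Z i.
  exists M, (Y `&` [set i | N <= i]).
    by apply: filterI => //; exact: generated_filter_cofinite.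
  by move=> i [Yi Ni] Gi; apply: lX => // Z; exact: MY.
elim: l lSG {lX} => [_|Z l IH lSG].
  by exists 0, setT => //; exact: filterT.
have [|M [Y SY MY]] := IH.
  by move=> T Tl; apply: lSG; rewrite inE Tl orbT.
case: (lSG Z (mem_head _ _)) => [SZ|[m _ GmZ]].
  exists M, (Y `&` Z).
    by apply: filterI => //; exact: generated_filter_sub.
  by move=> i [Yi Zi] Gi T; rewrite inE => /orP[/eqP->//|]; exact: MY.
exists (maxn M m.+1), Y => // i Yi Gi T; rewrite inE => /orP[/eqP->|].
  by rewrite -GmZ; apply: Gi; exact: leq_maxr.
by apply: MY => // k kM; apply: Gi; exact: leq_trans (leq_maxl _ _).
Qed.

Lemma centered_adjoin_or S X : centered S ->
  centered (S `|` range (fun _ : nat => ~` X)) \/ generated_filter S X.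
Proof.
move=> cS; have [|nc] := pselect (centered (S `|` range (fun _ : nat => ~` X))).
  by left.
right; apply: contrapT => nX; apply: nc => Y /generated_filter_adjoin.
move=> [M [Z SZ ZY]]; apply: contrapT => Y0; apply: nX.
apply: filterS SZ => i Zi; apply: contrapT => nXi.
by apply: Y0; exists i; exact: ZY.
Qed.

Lemma code_large (code : nat * nat -> nat) (pos : nat -> nat * nat) n m i :
  cancel code pos -> \max_(k < n) (pos k).2 < i -> n <= code (m, i).
Proof.
move=> codeK; apply: contraTT; rewrite -ltnNge -leqNgt => lt.
have := leq_bigmax (Ordinal lt) (F := fun k : 'I_n => (pos k).2).
by rewrite codeK.
Qed.

Section Stage.
Context (code : nat * nat -> nat) (pos : nat -> nat * nat).

Definition flatten_point (x : nat -> nat -> bool) : nat -> bool :=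
  fun k => x (pos k).1 (pos k).2.

Definition cylinder_dense (D : nat -> nat -> nat -> bool) : Prop :=
  forall x n, exists i, mkseq (flatten_point (D i)) n = mkseq x n.

Definition refuses (G : nat -> set nat) (D : nat -> nat -> nat -> bool) :
    Prop :=
  exists k n m, G k = ~` [set i | D n m i].

(** If an ultrafilter U contains all the sets G m, then either one of the two
    sequences leaves U^nat, or, when both are dense, a tree automorphism maps
    the points of the first onto those of the second and fixes, in coordinate
    m of any point, the bits with index in G m. *)
Definition settles
    (DE : (nat -> nat -> nat -> bool) * (nat -> nat -> nat -> bool))
    (G : nat -> set nat) : Prop :=
  [\/ refuses G DE.1, refuses G DE.2 |
    cylinder_dense DE.1 -> cylinder_dense DE.2 ->
    exists flips,
      [/\ forall i, exists j,
            twist flips (flatten_point (DE.1 i)) = flatten_point (DE.2 j),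
          forall j, exists i,
            twist flips (flatten_point (DE.1 i)) = flatten_point (DE.2 j) &
          forall m, G m = [set i | flips (code (m, i)) = [::]]]].

Definition members (A : set (nat -> bool))
    (B : (nat -> bool) -> nat -> set nat) : set (set nat) :=
  [set X | exists a m, A a /\ X = B a m].

Lemma members_seq A B (l : seq (set nat)) :
  (forall Y, Y \in l -> members A B Y) ->
  exists s ms, (forall a, a \in s -> A a) /\
    l = [seq B p.1 p.2 | p <- zip s ms].
Proof.
elim: l => [_|Y l IH lAB]; first by exists [::], [::].
have [|s [ms [sA lE]]] := IH.
  by move=> Z Zl; apply: lAB; rewrite inE Zl orbT.
have [a [m [Aa YE]]] := lAB Y (mem_head _ _).
exists (a :: s), (m :: ms); rewrite /= -YE -lE; split=> // b.
by rewrite inE => /orP[/eqP->|/sA].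
Qed.

Context (codeK : cancel code pos).

(** If no complement of a coordinate can be added, then all coordinates of the
    points of D and E are in the generated filter, and so is the set of i at
    which finitely many of them contain i.  Any such i gives levels
    code (m, i), m < M, at which all these points have the bit true, hence
    agree, as the requirements of the generic twist ask. *)
Lemma settling_stage A B DE :
  MA_countable -> ~ generates A -> centered (members A B) ->
  exists G, centered (members A B `|` range G) /\ settles DE G.
Proof.
case: DE => D E MA nA cS; set S := members A B.
have [[n [m cD]]|nD] := pselect (exists n m,
    centered (S `|` range (fun _ : nat => ~` [set i | D n m i]))).
  exists (fun=> ~` [set i | D n m i]); split=> //.
  by constructor 1; exists 0, n, m.
have [[n [m cE]]|nE] := pselect (exists n m,
    centered (S `|` range (fun _ : nat => ~` [set i | E n m i]))).
  exists (fun=> ~` [set i | E n m i]); split=> //.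
  by constructor 2; exists 0, n, m.
have SD n m : generated_filter S [set i | D n m i].
  have [c|//] := centered_adjoin_or [set i | D n m i] cS.
  by case: nD; exists n, m.
have SE n m : generated_filter S [set i | E n m i].
  have [c|//] := centered_adjoin_or [set i | E n m i] cS.
  by case: nE; exists n, m.
have [[Ddense Edense]|nde] :=
  pselect (cylinder_dense D /\ cylinder_dense E); last first.
  exists (fun=> setT); split; last by constructor 3 => ? ?; case: nde.
  move=> X /generated_filter_adjoin[M [Y SY YX]].
  by have [i Yi] := cS Y SY; exists i; exact: YX.
(* The requirement for M, N and the sets B a m, (a, m) in zip s ms: freedom of
   flips at (m, i), m < M, for some i >= N in all these sets. *)
pose K n s : set (seq nat) :=
  if (unpickle n : option (nat * nat * seq nat)) is Some (M, N, ms) then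
    [set ks | exists i, [/\ N <= i,
      forall Y, Y \in [seq B p.1 p.2 | p <- zip s ms] -> Y i &
      ks = [seq code (m, i) | m <- iota 0 M]]]
  else [set [::]].
have [||n s sA g N0|flips [fwd bwd unfl]] := generic_twist (K := K) MA nA
  (D := fun i => flatten_point (D i)) (E := fun j => flatten_point (E j)).
- exact: Ddense.
- exact: Edense.
- rewrite /K; case: unpickle => [[[M N] ms]|]; last by exists [::].
  pose W := \max_(k < N0) (pos k).2.
  have SW : generated_filter S ([set i | maxn N W.+1 <= i] `&`
     [set i | forall Y, Y \in [seq B p.1 p.2 | p <- zip s ms] -> Y i] `&`
     [set i | forall m, m \in iota 0 M -> forall p, p \in g ->
        D p.1 m i /\ E p.2 m i]).
    apply: filterI; first apply: filterI.
    + exact: generated_filter_cofinite.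
    + apply: (filter_all (X := id)) => Y /mapP[[a m] ap ->].
      apply: generated_filter_sub; exists a, m; split=> //; apply: sA.
      exact: mem_zipl ap.
    + apply: (filter_all (X := fun m => [set i | forall p, p \in g ->
        D p.1 m i /\ E p.2 m i])) => m _.
      apply: (filter_all (X := fun p => [set i | D p.1 m i /\ E p.2 m i])).
      move=> p _.
      exact: filterI (SD p.1 m) (SE p.2 m).
  have [i [[/= + BYi] DEi]] := cS _ SW; rewrite geq_max => /andP[Ni Wi].
  exists [seq code (m, i) | m <- iota 0 M]; first by exists i.
  move=> _ /mapP[m mM ->]; split.
    exact: code_large codeK Wi.
  move=> p pg; rewrite /flatten_point codeK /=.
  by have [-> ->] := DEi m mM p pg.
exists (fun m => [set i | flips (code (m, i)) = [::]]); split; last first.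
  by constructor 3 => _ _; exists flips.
move=> X /generated_filter_adjoin[M [Y [l lS [N lY]] YX]].
have [s [ms [sA lE]]] := members_seq lS.
have [ks] := unfl (pickle (M, N, ms)) s sA.
rewrite /K pickleK => -[i [Ni li ->]] ksP; exists i; apply: YX.
  by apply: lY => // Z; rewrite lE; exact: li.
move=> m mM; apply: ksP; apply/mapP; exists m => //.
by rewrite mem_iota.
Qed.
End Stage.

(** * The transfinite construction *)

(** The hypothesis of locality says that Q a B t depends on B only below a, so
    that t can be chosen as soon as the values of B below a are known. *)
Lemma well_founded_choice (I T : Type) (lt : I -> I -> Prop) (t0 : T)
    (Q : I -> (I -> T) -> T -> Prop) :
  well_founded lt ->
  (forall a B, exists t, Q a B t) ->
  (forall a B B' t, (forall b, lt b a -> B b = B' b) -> Q a B t -> Q a B' t) ->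
  exists B, forall a, Q a B (B a).
Proof.
move=> wf Qex Qlocal.
have /choice[step stepP] (aB : I * (I -> T)) : exists t, Q aB.1 aB.2 t.
  exact: Qex.
pose pad a (f : forall b, lt b a -> T) b :=
  if pselect (lt b a) is left ba then f b ba else t0.
pose B := Fix wf (fun _ => T) (fun a f => step (a, pad a f)).
have BE a : B a = step (a, pad a (fun b _ => B b)).
  rewrite /B Fix_eq // => b f g fg; congr (step (b, _)).
  by apply/funext => c; rewrite /pad; case: pselect.
exists B => a; apply: Qlocal (pad a (fun b _ => B b)) _ _ _ _.
  by move=> b ba; rewrite /pad; case: pselect.
by rewrite BE; exact: (stepP (a, _)).
Qed.

Lemma uncountable_cantor : ~ countable [set: nat -> bool].
Proof.
move=> /countable_injP[f finj].
pose diag n := ~~ `[< exists2 x : nat -> bool, f x = n & x n >].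
have [dT|/negP dF] := boolP (diag (f diag)).
  by move: (dT) => /negP; apply; apply/asboolP; exists diag.
apply: dF; apply/negP => /asboolP[x fx]; rewrite -fx.
by rewrite (finj x diag) ?inE // => dT; move: (dT) => /negP; apply;
  apply/asboolP; exists diag.
Qed.

Lemma decoding_surjective :
  exists dec : (nat -> bool) ->
      (nat -> nat -> nat -> bool) * (nat -> nat -> nat -> bool),
    forall DE, exists a, dec a = DE.
Proof.
exists (fun a => (fun n m i => a (pickle (true, n, m, i)),
                  fun n m i => a (pickle (false, n, m, i)))) => -[D E].
exists (fun k => if (unpickle k : option (bool * nat * nat * nat))
  is Some (b, n, m, i) then (if b then D else E) n m i else true).
by congr pair; apply/funext => n; apply/funext => m; apply/funext => i;
  rewrite pickleK.
Qed.

(** Stages are indexed by 2^nat, which has enough points to code all the pairs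
    of sequences, well-ordered with nongenerating initial segments. *)
Lemma settling_filter (code : nat * nat -> nat) (pos : nat -> nat * nat) :
  MA_countable -> cancel code pos ->
  exists F : set_system nat, [/\ ProperFilter F, forall N, F [set i | N <= i] &
    forall DE, exists G, (forall m, F (G m)) /\ settles code pos DE G].
Proof.
move=> MA codeK.
have [lt [[wf tr tri] nongen]] := nongenerating_well_order uncountable_cantor.
have [dec dec_surj] := decoding_surjective.
pose below a := [set b | lt b a].
pose upto a := [set b | b = a \/ lt b a].
have [|a B|B BP] := well_founded_choice (T := nat -> set nat) (fun=> setT)
  (Q := fun a B t => centered (members (below a) B) ->
     centered (members (below a) B `|` range t) /\
     settles code pos (dec a) t) wf.
- move=> a B; have [cB|ncB] := pselect (centered (members (below a) B)).
    by have [G GP] := settling_stage codeK (dec a) MA (nongen a) cB; exists G.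
  by exists (fun=> setT).
- move=> B' t BB'; suff -> : members (below a) B' = members (below a) B by [].
  by apply/seteqP; split=> _ [b [m [ba ->]]]; exists b, m; rewrite BB'.
(* Finitely many members appear up to a common stage. *)
have chain (P : set (nat -> bool)) :
    (forall a, P a -> centered (members (upto a) B)) -> centered (members P B).
  move=> cB X [l lP [N lX]].
  suff [l0|[a Pa la]] : l = [::] \/
      exists2 a, P a & forall Y, Y \in l -> members (upto a) B Y.
  - by exists N; apply: lX; rewrite // l0.
  - by apply: (cB a Pa); exists l => //; exists N.
  elim: l lP {lX} => [_|Y l IH lP]; first by left.
  right; have [b [m [Pb YE]]] := lP Y (mem_head _ _).
  have [|->|[a Pa la]] := IH.
  - by move=> Z Zl; apply: lP; rewrite inE Zl orbT.
  - by exists b => // Z; rewrite inE => /eqP->; exists b, m; split=> //; left.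
  have [ab|bE|ba] := tri a b.
  - exists b => // Z; rewrite inE => /orP[/eqP->|/la[c [k [ca ->]]]].
      by exists b, m; split=> //; left.
    exists c, k; split=> //; right; case: ca => [->//|ca]; exact: tr ab.
  - exists a => // Z; rewrite inE => /orP[/eqP->|/la//].
    by exists b, m; split=> //; left.
  - exists a => // Z; rewrite inE => /orP[/eqP->|/la//].
    by exists b, m; split=> //; right.
have cupto a : centered (members (upto a) B).
  elim/(well_founded_ind wf): a => a IH.
  have [cB _] := BP a (chain _ IH).
  suff -> : members (upto a) B = members (below a) B `|` range (B a) by [].
  apply/seteqP; split=> X.
    by move=> [b [m [[->|ba] ->]]]; [right; exists m|left; exists b, m].
  by case=> [[b [m [ba ->]]]|[m _ <-]]; [exists b, m|exists a, m]; split=> //;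
    [right|left].
exists (generated_filter (members setT B)); split.
- apply: Build_ProperFilter_ex => X; exact: chain.
- by move=> N; exact: generated_filter_cofinite.
- move=> DE; have [a <-] := dec_surj DE; exists (B a); split.
    by move=> m; apply: generated_filter_sub; exists a, m.
  by have [] := BP a (chain _ (fun b _ => cupto b)).
Qed.

(** * The infinite power of the ultrafilter *)

Lemma continuous_prod_topology (J : Type) (T : topologicalType)
    (K : J -> topologicalType) (f : T -> prod_topology K) :
  (forall j, continuous (fun x => f x j)) -> continuous f.
Proof.
move=> fc x; apply/cvg_sup => j V [W [[O oO <-] Ofx] WV].
apply: filterS WV _; apply: (fc j x O); exact: open_nbhs_nbhs.
Qed.

Section PowerOfFilter.
Context (U : set_system nat).
Local Notation X := (infinite_power (char_space U)).

Definition entry (x : X) : nat -> nat -> bool :=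
  fun m => (set_val (x m : char_functions U) : cantor_space).

Lemma entry_in (x : X) m : U [set i | entry x m i].
Proof. exact: (set_valP (x m : char_functions U)). Qed.

Definition point_of (z : nat -> nat -> bool)
    (Uz : forall m, U [set i | z m i]) : X :=
  fun m => SigSub (mem_set (Uz m : char_functions U (z m))).

Lemma entry_point_of (z : nat -> nat -> bool)
    (Uz : forall m, U [set i | z m i]) : entry (point_of Uz) = z.
Proof. by []. Qed.

Lemma entry_inj : injective entry.
Proof.
move=> x y e; apply: functional_extensionality_dep => m; apply: val_inj.
exact: (congr1 (@^~ m) e).
Qed.

Lemma entry_continuous m i : continuous (fun x : X => entry x m i).
Proof.
move=> x; apply: (@continuous_comp X (char_space U) bool (fun x => x m)
  (fun y => (set_val (y : char_functions U) : cantor_space) i)).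
  exact: (@proj_continuous nat (fun _ => char_space U) m).
apply: (@continuous_comp (char_space U) cantor_space bool
  (fun y => set_val (y : char_functions U)) (fun z => z i)).
  exact: initial_continuous.
exact: (@proj_continuous nat (fun _ => bool) i).
Qed.

Lemma power_continuous (T : topologicalType) (f : T -> X) :
  (forall m i, continuous (fun x => entry (f x) m i)) -> continuous f.
Proof.
move=> fc; apply: continuous_prod_topology => m.
apply: (@continuous_comp_initial _ _ _
  (set_val : char_functions U -> cantor_space)).
apply: (@continuous_prod_topology nat T (fun _ => bool)) => i.
exact: fc.
Qed.
End PowerOfFilter.

Lemma countable_enumeration (T : Type) (A : set T) :
  countable A -> A !=set0 -> exists f : nat -> T, A = range f.
Proof.
move=> /pfcard_geP[->[]//|[f]] _.
exists f; apply/seteqP; split=> [x Ax|_ [n _ <-]]; last exact: funS.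
by have [n _ <-] := @surj _ _ _ _ f x Ax; exists n.
Qed.

Section CodedPower.
Context (U : set_system nat) (UF : Filter U).
Context (code : nat * nat -> nat) (pos : nat -> nat * nat).
Context (codeK : cancel code pos) (posK : cancel pos code).
Local Notation X := (infinite_power (char_space U)).

Definition flat_entry (x : X) : nat -> bool := flatten_point pos (entry x).

Lemma flat_entryE x m i : flat_entry x (code (m, i)) = entry x m i.
Proof. by rewrite /flat_entry /flatten_point codeK. Qed.

Lemma flat_entry_inj : injective flat_entry.
Proof.
move=> x y e; apply: entry_inj; apply/funext => m; apply/funext => i.
by rewrite -!flat_entryE e.
Qed.

Lemma nbhs_cylinder (x : X) n :
  nbhs x [set y | mkseq (flat_entry y) n = mkseq (flat_entry x) n].
Proof.
suff near_x : nbhs x [set y | forall k, k \in iota 0 n ->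
    flat_entry y k = flat_entry x k].
  apply: filterS near_x => y yx; apply/mkseqP => k kn; apply: yx.
  by rewrite mem_iota.
apply: (filter_all (X := fun k => [set y | flat_entry y k = flat_entry x k])).
move=> k _.
apply: (@entry_continuous U (pos k).1 (pos k).2 x [set b | b = flat_entry x k]).
by rewrite nbhs_principalE; apply/principal_filterP.
Qed.

Lemma continuous_cylinder (f : X -> X) :
  (forall x y n, mkseq (flat_entry x) n = mkseq (flat_entry y) n ->
     mkseq (flat_entry (f x)) n = mkseq (flat_entry (f y)) n) ->
  continuous f.
Proof.
move=> flocal; apply: power_continuous => m i x V /=.
rewrite nbhs_principalE => /principal_filterP Vfx.
apply: filterS (nbhs_cylinder x (code (m, i)).+1) => y /flocal /mkseqP e /=.
by rewrite -flat_entryE e // flat_entryE.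
Qed.

(** U^nat is dense in (2^nat)^nat since U contains the cofinite sets, so density
    in U^nat is density in (2^nat)^nat. *)
Lemma cylinder_dense_range (D : nat -> X) :
  (forall N, U [set i | N <= i]) -> dense (range D) ->
  cylinder_dense pos (fun n => entry (D n)).
Proof.
move=> Ucof Ddense z n.
pose w m i := if code (m, i) < n then z (code (m, i)) else true.
have Uw m : U [set i | w m i].
  apply: filterS (Ucof (\max_(k < n) (pos k).2).+1) => i /= ni.
  by rewrite /w ltnNge (code_large m codeK ni).
pose O := [set y : X | mkseq (flat_entry y) n = mkseq z n].
have [||y [Oy [i _ Diy]]] := Ddense O.
- exists (point_of Uw); apply/mkseqP => k kn.
  by rewrite -(posK k); case: (pos k) (posK k) => m i kE;
    rewrite flat_entryE entry_point_of /w kE kn.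
- rewrite openE => y Oy; apply: filterS (nbhs_cylinder y n) => y' /= e.
  by rewrite /O /= e.
by exists i; rewrite -Oy -Diy.
Qed.

(** A map of flattened points that changes each coordinate only outside a
    set of U preserves U^nat. *)
Lemma lift_exists (h : (nat -> bool) -> nat -> bool) :
  (forall x m, U [set i | h (flat_entry x) (code (m, i)) = entry x m i]) ->
  (forall x y n, mkseq x n = mkseq y n -> mkseq (h x) n = mkseq (h y) n) ->
  exists2 f : X -> X, continuous f &
    forall x, flat_entry (f x) = h (flat_entry x).
Proof.
move=> hU hlocal.
have Uh x m : U [set i | h (flat_entry x) (code (m, i))].
  by apply: filterS (filterI (hU x m) (entry_in x m)) => i /= [->].
have hE x : flat_entry (point_of (Uh x)) = h (flat_entry x).
  apply/funext => k; rewrite -(posK k); case: (pos k) => m i.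
  by rewrite flat_entryE entry_point_of.
exists (fun x => point_of (Uh x)) => //.
by apply: continuous_cylinder => x y n; rewrite !hE; exact: hlocal.
Qed.

Lemma twist_homeomorphism flips :
  (forall m, U [set i | flips (code (m, i)) = [::]]) ->
  exists f : X -> X, homeomorphism f /\
    forall x, flat_entry (f x) = twist flips (flat_entry x).
Proof.
move=> Uflips.
have [||f fc fE] := @lift_exists (twist flips).
- move=> x m; apply: filterS (Uflips m) => i /= nofl.
  by rewrite /twist nofl addbF flat_entryE.
- by move=> x y n; exact: (eq_mkseq_twist flips x y n).2.
have [||g gc gE] := @lift_exists (untwist flips).
- move=> x m; apply: filterS (Uflips m) => i /= nofl.
  by rewrite /untwist nofl addbF flat_entryE.
- by move=> x y n; exact: mkseq_untwist_eq.
exists f; split=> //; split=> //; exists g; split=> // x; apply: flat_entry_inj.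
  by rewrite gE fE twistK.
by rewrite fE gE untwistK.
Qed.

End CodedPower.

Lemma pair_coding : exists (code : nat * nat -> nat) (pos : nat -> nat * nat),
  cancel code pos /\ cancel pos code.
Proof.
have /card_set_bijP[code] := card_nat2.
rewrite setTT_bijective => -[pos codeK posK].
by exists code, pos.
Qed.

Theorem theorem24 :
  MA_countable ->
  exists U : set_system nat,
    [/\ UltraFilter U, nonprincipal U &
        countable_dense_homogeneous (infinite_power (char_space U))].
Proof.
move=> MA; have [code [pos [codeK posK]]] := pair_coding.
have [F [Fproper Fcof Fsettles]] := settling_filter MA codeK.
have [U [Uultra FU]] := ultraFilterLemma Fproper.
have Ucof N : U [set i | N <= i] by exact: FU.
exists U; split=> //.
  move=> n Un; have : U [set n] by rewrite Un; apply/principal_filterP.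
  move=> /(filterI (Ucof n.+1))/filter_ex[i [/= ni iE]].
  by rewrite iE ltnn in ni.
move=> D E Dcount Ddense Ecount Edense.
have X0 : [set: infinite_power (char_space U)] !=set0.
  have UT (m : nat) : U [set i : nat | true] by apply: filterS filterT => i.
  by exists (point_of UT).
have dense_range (C : set (infinite_power (char_space U))) :
    countable C -> dense C -> exists c : nat -> _, C = range c.
  move=> Ccount /(_ _ X0 openT)[x [_ Cx]].
  by apply: countable_enumeration Ccount _; exists x.
have [d DE] := dense_range D Dcount Ddense.
have [e EE] := dense_range E Ecount Edense.
rewrite {}DE {}EE {D E Dcount Ecount} in Ddense Edense *.
have [G [FG Gsettles]] := Fsettles (fun n => entry (d n), fun n => entry (e n)).
have norefusal (z : nat -> infinite_power (char_space U)) :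
    ~ refuses G (fun n => entry (z n)).
  move=> [k [n [m Gk]]]; have := FU _ (FG k); rewrite Gk.
  by move=> /(filterI (entry_in (z n) m))/filter_ex[i []].
case: Gsettles => [/norefusal//|/norefusal//|].
case=> [||flips [forth back GE]]; [exact: cylinder_dense_range..|].
have [|f [fhomeo fE]] := @twist_homeomorphism U _ code pos codeK posK flips.
  by move=> m; rewrite -GE; exact: FU.
exists f; split=> //; apply/seteqP; split=> [_ [_ [i _ <-] <-]|_ [j _ <-]].
  by have [j ij] := forth i; exists j => //; apply: (flat_entry_inj codeK);
    rewrite fE.
have [i ij] := back j; exists (d i); first by exists i.
by apply: (flat_entry_inj codeK); rewrite fE.
Qed.
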